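(* Let $A\in\mathcal{V}$ and let $\theta,\chi\in Con(A)$ with $\theta\subseteq\chi$ and $Max(A)\cap[\theta)_A=Max(A)\cap[\chi)_A$. If $\chi$ has $CBLP$ then $\theta$ has $CBLP$.
   Context: $\mathcal{V}$ is a congruence modular, semidegenerate variety (no nontrivial algebra has a one-element subalgebra) of finite signature. For $B\in\mathcal{V}$: $Con(B)$ is its congruence lattice with bounds $\Delta_B,\nabla_B$, $[\cdot,\cdot]$ the Freese–McKenzie commutator, $K(B)$ the compact congruences. A congruence $\phi\neq\nabla_B$ is prime if $[\alpha,\beta]\subseteq\phi$ implies $\alpha\subseteq\phi$ or $\beta\subseteq\phi$; $\rho(\theta)$ is the intersection of prime congruences containing $\theta$; $Max(B)$ is the set of maximal congruences; $[\theta)_B=\{\chi\in Con(B):\theta\subseteq\chi\}$. $B(Con(B))$ is the Boolean algebra of complemented elements of $Con(B)$. When $K(B)$ is closed under the commutator, the reticulation $L(B)=K(B)/{\equiv}$ ($\alpha\equiv\beta$ iff $\rho(\alpha)=\rho(\beta)$) is a bounded distributive lattice with canonical map $\lambda_B$, mapping $B(Con(B))$ injectively into $B(L(B))$; the reticulation preserves the Boolean center if this map is onto $B(L(B))$. Standing assumption: for every $B\in\mathcal{V}$, $K(B)$ is closed under the commutator and the reticulation of $B$ preserves the Boolean center. A congruence $\theta$ of $A$ has $CBLP$ if for every $\beta\in B(Con(A/\theta))$ there is $\alpha\in B(Con(A))$ with $(\alpha\vee\theta)/\theta=\beta$. *)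

(* Defs.v *)
From mathcomp Require Import all_boot.
From Stdlib Require Import ClassicalEpsilon.
Set Implicit Arguments. Unset Strict Implicit. Unset Printing Implicit Defensive.

Record signature := Signature { op_sym : finType; arity : op_sym -> nat }.

Record algebra (S : signature) := Algebra {
  carrier :> Type;
  interp : forall f : op_sym S, ('I_(arity f) -> carrier) -> carrier }.

Arguments interp {S} {a} f _.

Inductive term (S : signature) : Type :=
  | Var : nat -> term S
  | App : forall f : op_sym S, ('I_(arity f) -> term S) -> term S.

Fixpoint eval (S : signature) (A : algebra S) (v : nat -> A) (t : term S) : A :=
  match t with
  | Var n => v n
  | App f ts => interp f (fun i => eval v (ts i))
  end.

(* A variety, given by a set of identities (Birkhoff). *)
Definition identities (S : signature) := term S -> term S -> Prop.

Definition in_var (S : signature) (E : identities S) (A : algebra S) : Prop :=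
  forall s t, E s t -> forall v : nat -> A, eval v s = eval v t.

Definition prel (T : Type) := T -> T -> Prop.

Definition rsub T (a b : prel T) := forall x y, a x y -> b x y.
Definition req T (a b : prel T) := forall x y, a x y <-> b x y.

Definition is_con (S : signature) (A : algebra S) (r : prel A) : Prop :=
  (forall x, r x x) /\ (forall x y, r x y -> r y x) /\
  (forall x y z, r x y -> r y z -> r x z) /\
  (forall (f : op_sym S) (a b : 'I_(arity f) -> A),
      (forall i, r (a i) (b i)) -> r (interp f a) (interp f b)).

Definition Delta (T : Type) : prel T := fun x y => x = y.
Definition Nabla (T : Type) : prel T := fun _ _ => True.

Definition cmeet T (a b : prel T) : prel T := fun x y => a x y /\ b x y.

Definition cbigjoin (S : signature) (A : algebra S) (F : prel A -> Prop) : prel A :=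
  fun x y => forall g, is_con g -> (forall b, F b -> rsub b g) -> g x y.

Definition cjoin (S : signature) (A : algebra S) (a b : prel A) : prel A :=
  cbigjoin (fun c => c = a \/ c = b).

Definition compact (S : signature) (A : algebra S) (a : prel A) : Prop :=
  is_con a /\
  forall F : prel A -> Prop, (forall b, F b -> is_con b) ->
    rsub a (cbigjoin F) ->
    exists l : seq (prel A), (forall b, List.In b l -> F b) /\
                            rsub a (cbigjoin (fun b => List.In b l)).

Definition splitv T (n : nat) (u v : nat -> T) : nat -> T :=
  fun i => if i < n then u i else v i.

Definition centralizes (S : signature) (A : algebra S) (a b d : prel A) : Prop :=
  forall (t : term S) (n : nat) (x1 x2 y1 y2 : nat -> A),
    (forall i, i < n -> a (x1 i) (x2 i)) ->
    (forall i, n <= i -> b (y1 i) (y2 i)) ->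
    d (eval (splitv n x1 y1) t) (eval (splitv n x1 y2) t) ->
    d (eval (splitv n x2 y1) t) (eval (splitv n x2 y2) t).

Definition commutator (S : signature) (A : algebra S) (a b : prel A) : prel A :=
  fun x y => forall d, is_con d -> centralizes a b d -> d x y.

Definition prime_con (S : signature) (A : algebra S) (p : prel A) : Prop :=
  is_con p /\ ~ req p (@Nabla A) /\
  forall a b, is_con a -> is_con b -> rsub (commutator a b) p ->
    rsub a p \/ rsub b p.

Definition rad (S : signature) (A : algebra S) (t : prel A) : prel A :=
  fun x y => forall p, prime_con p -> rsub t p -> p x y.

Definition max_con (S : signature) (A : algebra S) (m : prel A) : Prop :=
  is_con m /\ ~ req m (@Nabla A) /\
  forall c, is_con c -> rsub m c -> req c m \/ req c (@Nabla A).

Definition complemented (S : signature) (A : algebra S) (a : prel A) : Prop :=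
  is_con a /\ exists b, is_con b /\ req (cmeet a b) (@Delta A) /\
                        req (cjoin a b) (@Nabla A).

(** * Reticulation L(A) = K(A)/== with a == b iff rad a = rad b.
   Its lattice operations: [a] /\ [b] = [[a,b]], [a] \/ [b] = [a \/ b],
   0 = [Delta], 1 = [Nabla]. *)
Definition ret_eq (S : signature) (A : algebra S) (a b : prel A) : Prop :=
  req (rad a) (rad b).

(* [a] (a compact) lies in the Boolean centre B(L(A)) *)
Definition ret_complemented (S : signature) (A : algebra S) (a : prel A) : Prop :=
  compact a /\ exists b, compact b /\
    ret_eq (commutator a b) (@Delta A) /\ ret_eq (cjoin a b) (@Nabla A).

Definition compacts_closed_comm (S : signature) (A : algebra S) : Prop :=
  forall a b : prel A, @compact S A a -> @compact S A b ->
    @compact S A (commutator a b).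

(* lambda_A maps B(Con(A)) onto B(L(A)) *)
Definition ret_preserves_boolean (S : signature) (A : algebra S) : Prop :=
  forall a : prel A, @ret_complemented S A a ->
    exists c : prel A, @complemented S A c /\ @compact S A c /\ ret_eq c a.

Definition con_modular (S : signature) (E : identities S) : Prop :=
  forall B : algebra S, in_var E B ->
    forall a b c : prel B, is_con a -> is_con b -> is_con c -> rsub a c ->
      req (cmeet (cjoin a b) c) (cjoin a (cmeet b c)).

Definition nontrivial (S : signature) (B : algebra S) : Prop :=
  exists x y : B, x <> y.

Definition one_elt_subalg (S : signature) (B : algebra S) (a : B) : Prop :=
  forall (f : op_sym S) (args : 'I_(arity f) -> B),
    (forall i, args i = a) -> interp f args = a.

Definition semidegenerate (S : signature) (E : identities S) : Prop :=
  forall B : algebra S, in_var E B -> nontrivial B ->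
    forall a : B, ~ one_elt_subalg a.

Definition standing_assumption (S : signature) (E : identities S) : Prop :=
  forall B : algebra S, in_var E B ->
    compacts_closed_comm B /\ ret_preserves_boolean B.

Section Quotient.
Variables (S : signature) (A : algebra S) (th : prel A).

Definition qcarrier : Type := {P : A -> Prop | exists x, P = th x}.

Definition qrep (X : qcarrier) : A :=
  proj1_sig (constructive_indefinite_description _ (proj2_sig X)).

Definition qclass (x : A) : qcarrier := exist _ (th x) (ex_intro _ x erefl).

Definition qinterp (f : op_sym S) (args : 'I_(arity f) -> qcarrier) : qcarrier :=
  qclass (interp f (fun i => qrep (args i))).

Definition quotient_alg : algebra S := @Algebra S qcarrier qinterp.

Definition qcon (a : prel A) : prel quotient_alg :=
  fun X Y => exists x y, proj1_sig X x /\ proj1_sig Y y /\ cjoin a th x y.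
End Quotient.

Definition CBLP (S : signature) (A : algebra S) (th : prel A) : Prop :=
  forall b : prel (quotient_alg th), complemented b ->
    exists a : prel A, complemented a /\ req (@qcon S A th a) b.

(* Main.v *)
From Stdlib Require Import Relations ClassicalEpsilon.
From mathcomp Require Import boolp classical_sets.
Require Import Defs.
From mathcomp Require Import all_boot.

(** The heart of the matter is a distributive law: if [a] and [a'] are
   congruences with join [Nabla] and [cmeet a a'] below [d], then
   [cmeet (cjoin a d) (cjoin a' d)] is below [d]. Modularity enters through
   Gumm's shifting lemma, which makes centrality additive and symmetric and so
   shows that [Nabla] centralizes that meet modulo [d]; semidegeneracy then
   collapses a congruence centralized by [Nabla].

   Given [b], [b'] complementary modulo [th], the distributive law makes their
   joins with [ch] complementary modulo [ch], so CBLP of [ch] yields [c], [c']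
   complementary with [cjoin c ch = cjoin b ch]. A maximal congruence above [th]
   lies above [ch], hence contains [c] iff it contains [b]; since every proper
   congruence lies below a maximal one, [cjoin c b'] and [cjoin c' b] are
   [Nabla], and the distributive law turns this into [cjoin c th = b]. *)

Set Implicit Arguments. Unset Strict Implicit. Unset Printing Implicit Defensive.

(** * Congruences of an algebra and their joins *)

Section Congruences.
Variables (S : signature) (A : algebra S).
Implicit Types a b c d : prel A.

Lemma con_refl a : is_con a -> forall x, a x x.
Proof. by case. Qed.

Lemma con_sym a : is_con a -> forall x y, a x y -> a y x.
Proof. by case=> _ []. Qed.

Lemma con_trans a : is_con a -> forall x y z, a x y -> a y z -> a x z.
Proof. by case=> _ [_ []]. Qed.

Lemma con_op a : is_con a -> forall (f : op_sym S) (u v : 'I_(arity f) -> A),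
  (forall i, a (u i) (v i)) -> a (interp f u) (interp f v).
Proof. by case=> _ [_ []]. Qed.

Lemma req_eq a b : req a b -> a = b.
Proof. by move=> ab; apply/funext=> x; apply/funext=> y; apply/propext/ab. Qed.

Lemma rsub_anti a b : rsub a b -> rsub b a -> req a b.
Proof. by move=> ab ba x y; split; [apply: ab|apply: ba]. Qed.

Lemma is_con_Delta : is_con (@Delta A).
Proof.
split=> //; split; first by move=> x y ->.
split; first by move=> x y z -> ->.
by move=> f u v /funext ->.
Qed.

Lemma is_con_cmeet a b : is_con a -> is_con b -> is_con (cmeet a b).
Proof.
move=> ha hb; split; first by move=> x; split; exact: con_refl.
split; first by move=> x y [? ?]; split; exact: con_sym.
split.
  move=> x y z [axy bxy] [ayz byz].
  by split; [exact: con_trans axy ayz|exact: con_trans bxy byz].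
by move=> f u v uv; split; apply: con_op => // i; case: (uv i).
Qed.

Lemma is_con_cbigjoin (F : prel A -> Prop) : is_con (cbigjoin F).
Proof.
split; first by move=> x g hg _; exact: con_refl.
split; first by move=> x y xy g hg Fg; apply: con_sym => //; exact: xy.
split.
  move=> x y z xy yz g hg Fg.
  exact: (con_trans hg (xy g hg Fg) (yz g hg Fg)).
by move=> f u v uv g hg Fg; apply: con_op => // i; exact: uv.
Qed.

Lemma is_con_cjoin a b : is_con (cjoin a b).
Proof. exact: is_con_cbigjoin. Qed.

Lemma rsub_cjoinl a b : rsub a (cjoin a b).
Proof. by move=> x y xy g hg; apply; [left|]. Qed.

Lemma rsub_cjoinr a b : rsub b (cjoin a b).
Proof. by move=> x y xy g hg; apply; [right|]. Qed.

Lemma cjoin_least a b c :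
  is_con c -> rsub a c -> rsub b c -> rsub (cjoin a b) c.
Proof. by move=> hc ac bc x y; apply=> // d [] ->. Qed.

(* Change the arguments of an operation one at a time. *)
Lemma is_con_clos_rst (R : prel A) :
  (forall (f : op_sym S) (u v : 'I_(arity f) -> A) (j : 'I_(arity f)),
     (forall i, i != j -> u i = v i) -> R (u j) (v j) ->
     R (interp f u) (interp f v)) ->
  is_con (clos_refl_sym_trans A R).
Proof.
move=> Rop; split; first by move=> x; exact: rst_refl.
split; first by move=> x y; exact: rst_sym.
split; first by move=> x y z; exact: rst_trans.
move=> f u v uv.
have one (w w' : 'I_(arity f) -> A) j : (forall i, i != j -> w i = w' i) ->
    clos_refl_sym_trans A R (w j) (w' j) ->
    clos_refl_sym_trans A R (interp f w) (interp f w').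
  move=> ww' jj.
  pose upd x i := if i == j then x else w i.
  have [-> ->] : w = upd (w j) /\ w' = upd (w' j).
    by split; apply/funext => i; rewrite /upd; case: eqP => [->//|/eqP/ww' ->].
  elim: jj => {ww' w'} [x y xy|x|x y _|x y z _ xy _].
  - by apply/rst_step/(@Rop _ _ _ j); rewrite /upd ?eqxx // => i /negbTE ->.
  - exact: rst_refl.
  - exact: rst_sym.
  - exact: rst_trans.
pose hyb k (i : 'I_(arity f)) := if i < k then v i else u i.
have hyb_step k : k <= arity f ->
    clos_refl_sym_trans A R (interp f u) (interp f (hyb k)).
  elim: k => [_|k IHk kf].
    by rewrite (_ : hyb 0 = u); [exact: rst_refl|apply/funext].
  apply: rst_trans (IHk (ltnW kf)) _; apply: (one _ _ (Ordinal kf)) => [i|].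
    by rewrite -(inj_eq val_inj) /hyb ltnS [i <= k]leq_eqVlt /= => /negbTE ->.
  by rewrite /hyb /= ltnn ltnSn.
have := hyb_step _ (leqnn _); rewrite (_ : hyb _ = v) //.
by apply/funext => i; rewrite /hyb ltn_ord.
Qed.

Lemma clos_rst_saturated (R : prel A) (P : A -> Prop) :
  (forall x y, R x y -> (P x <-> P y)) ->
  forall x y, clos_refl_sym_trans A R x y -> (P x <-> P y).
Proof.
move=> RP x y; elim=> [? ? /RP //|//|? ? _ [? ?] //|? ? ? _ [? ?] _ [? ?]].
by split; auto.
Qed.

(** The equivalence closure of the union of [a] and [b] is already a congruence, so it contains the
    join, and invariance of [P] need only be checked along single steps. *)
Lemma cjoin_saturated a b (P : A -> Prop) : is_con a -> is_con b ->
  (forall x y, a x y -> P x -> P y) -> (forall x y, b x y -> P x -> P y) ->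
  forall x y, cjoin a b x y -> P x -> P y.
Proof.
move=> ha hb aP bP x y; pose R x y := a x y \/ b x y.
have hR : is_con (clos_refl_sym_trans A R).
  have opj c (hc : is_con c) (f : op_sym S) (u v : 'I_(arity f) -> A) j :
      (forall i, i != j -> u i = v i) -> c (u j) (v j) ->
      c (interp f u) (interp f v).
    move=> uv cj; apply: con_op => // i.
    by have [->//|/uv ->] := eqVneq i j; exact: con_refl.
  apply: is_con_clos_rst => f u v j uv [uvj|uvj].
    by left; exact: (opj _ ha _ _ _ j).
  by right; exact: (opj _ hb _ _ _ j).
move/(cjoin_least hR (fun x y xy => rst_step _ _ _ _ (or_introl xy))
                     (fun x y xy => rst_step _ _ _ _ (or_intror xy))).
suff RP z t : R z t -> (P z <-> P t) by case/(clos_rst_saturated RP).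
by case=> zt; split;
  [exact: aP|exact/aP/(con_sym ha)|exact: bP|exact/bP/(con_sym hb)].
Qed.

End Congruences.

(** * Quotient algebras and the correspondence theorem *)

Section Quotients.
Variables (S : signature) (A : algebra S) (th : prel A).
Hypothesis hth : is_con th.
Local Notation Q := (quotient_alg th).

Lemma qclass_eq x y : th x y -> qclass th x = qclass th y.
Proof.
move=> xy; apply: eq_exist; apply/funext => z; apply/propext; split.
  by apply: (con_trans hth); exact: con_sym.
exact: (con_trans hth).
Qed.

Lemma qclass_inj x y : qclass th x = qclass th y -> th x y.
Proof. by case=> ->; exact: con_refl. Qed.

Lemma qrepK (X : Q) : qclass th (qrep X) = X.
Proof.
case: X => P exP; apply: eq_exist; symmetry.
exact: (proj2_sig (ClassicalEpsilon.constructive_indefinite_description _ exP)).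
Qed.

Lemma qrep_class x : th (qrep (qclass th x)) x.
Proof. by apply: qclass_inj; rewrite qrepK. Qed.

Lemma qclass_op (f : op_sym S) (u : 'I_(arity f) -> A) :
  interp (a := Q) f (fun i => qclass th (u i)) = qclass th (interp f u).
Proof. by apply: qclass_eq; apply: con_op => // i; exact: qrep_class. Qed.

Lemma eval_quotient (v : nat -> Q) t :
  eval v t = qclass th (eval (fun n => qrep (v n)) t).
Proof.
elim: t => [n|f ts IH] /=; first by rewrite qrepK.
rewrite -qclass_op; congr (qinterp _).
by apply/funext => i; exact: IH.
Qed.

Lemma in_var_quotient (E : identities S) : in_var E A -> in_var E Q.
Proof. by move=> EA s t st v; rewrite !eval_quotient (EA _ _ st). Qed.

(** The two directions of the correspondence theorem. [qpush] reads [a] on chosen representatives;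
    the choice is immaterial once [a] is a congruence above [th]. *)
Definition qpull (b : prel Q) : prel A := fun x y => b (qclass th x) (qclass th y).
Definition qpush (a : prel A) : prel Q := fun X Y => a (qrep X) (qrep Y).

Lemma is_con_qpull b : is_con b -> is_con (qpull b).
Proof.
move=> hb; split; first by move=> x; exact: (con_refl hb).
split; first by move=> x y; exact: (con_sym hb).
split; first by move=> x y z; exact: (con_trans hb).
by move=> f u v uv; rewrite /qpull -!qclass_op; exact: (con_op hb).
Qed.

Lemma rsub_qpull b : is_con b -> rsub th (qpull b).
Proof. by move=> hb x y /qclass_eq xy; rewrite /qpull xy; exact: (con_refl hb). Qed.

Lemma qpush_class a x y : is_con a -> rsub th a ->
  qpush a (qclass th x) (qclass th y) <-> a x y.
Proof.
move=> ha tha; have rep z : a (qrep (qclass th z)) z by apply/tha/qrep_class.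
split=> xy.
  apply: (con_trans ha) (rep y); apply: (con_trans ha) xy.
  exact: con_sym.
by apply: (con_trans ha) (con_sym ha (rep y)); exact: (con_trans ha) xy.
Qed.

Lemma is_con_qpush a : is_con a -> rsub th a -> is_con (qpush a).
Proof.
move=> ha tha; split; first by move=> X; exact: (con_refl ha).
split; first by move=> X Y; exact: (con_sym ha).
split; first by move=> X Y Z; exact: (con_trans ha).
move=> f u v uv; apply: (proj2 (qpush_class _ _ ha tha)).
exact: con_op.
Qed.

Lemma qpullK b : qpush (qpull b) = b.
Proof. by apply/funext => X; apply/funext => Y; rewrite /qpush /qpull !qrepK. Qed.

Lemma qcon_qpush a : req (qcon (th := th) a) (qpush (cjoin a th)).
Proof.
have hj := is_con_cjoin a th; have tj := @rsub_cjoinr S A a th.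
move=> X Y; split=> [[x [y [Xx [Yy xy]]]]|XY]; last first.
  have cl (Z : Q) : proj1_sig Z (qrep Z).
    by rewrite -{1}(qrepK Z); exact: con_refl.
  by exists (qrep X), (qrep Y).
have cl (Z : Q) z : proj1_sig Z z -> Z = qclass th z.
  by rewrite -{1}(qrepK Z) /= => /qclass_eq <-; rewrite qrepK.
by rewrite (cl _ _ Xx) (cl _ _ Yy); apply/qpush_class.
Qed.

End Quotients.

(** * CBLP in terms of complements in the interval from [th] to [Nabla] *)

Definition complementary (S : signature) (A : algebra S) (th a a' : prel A) :=
  [/\ is_con a, is_con a', req (cmeet a a') th & req (cjoin a a') (@Nabla A)].

Lemma complementary_qpull (S : signature) (A : algebra S) (th : prel A)
    (b b' : prel (quotient_alg th)) :
  is_con th -> complementary (@Delta _) b b' ->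
  complementary th (qpull b) (qpull b').
Proof.
move=> hth [hb hb' mbb jbb]; split; [exact: is_con_qpull..| |].
  move=> x y; split=> [/mbb/qclass_inj|xy]; first exact.
  by split; exact: rsub_qpull.
move=> x y; split=> // _ g hg gb.
(* Both pulled-back congruences contain [th], so an upper bound [g] of them does too and can be
   pushed to the quotient. *)
have thg : rsub th g.
  by move=> u v uv; apply: (gb (qpull b)); [left|exact: rsub_qpull].
apply/(qpush_class hth _ _ hg thg).
apply: (proj2 (jbb _ _) I _ (is_con_qpush hth hg thg)) => d D X Y.
have -> : d = qpush (qpull d) by rewrite qpullK.
by apply: gb; case: D => ->; [left|right].
Qed.

Lemma complementary_qpush (S : signature) (A : algebra S) (th a a' : prel A) :
  is_con th -> complementary th a a' ->
  complementary (@Delta (quotient_alg th)) (qpush a) (qpush a').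
Proof.
move=> hth [ha ha' maa jaa].
have tha : rsub th a by move=> x y /maa [].
have tha' : rsub th a' by move=> x y /maa [].
split; [exact: is_con_qpush..| |].
  move=> X Y; split=> [/maa XY|->].
    by rewrite -(qrepK X) -(qrepK Y); exact: qclass_eq.
  by split; exact: (con_refl (is_con_qpush _ _ _)).
move=> X Y; split=> // _ g hg gb.
rewrite -(qrepK X) -(qrepK Y).
apply: (proj2 (jaa (qrep X) (qrep Y)) I (qpull g) (is_con_qpull hth hg)).
move=> d D x y xy; apply: (gb (qpush d)); first by case: D => ->; [left|right].
by case: D xy => ->; exact: (proj2 (qpush_class hth _ _ _ _)).
Qed.

(** The correspondence theorem carries complements in the quotient to complements in the interval
    above [th], so the rest of the argument can stay inside Con(A). *)
Lemma CBLPP (S : signature) (A : algebra S) (th : prel A) : is_con th ->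
  CBLP th <-> forall a a', complementary th a a' ->
    exists c c', complementary (@Delta A) c c' /\ req (cjoin c th) a.
Proof.
move=> hth; split=> [cblp a a' aa|lift b [hb [b' [hb' [mbb jbb]]]]].
  have [ha _ maa _] := aa; have tha : rsub th a by move=> x y /maa [].
  have [hb hb' mbb jbb] := complementary_qpush hth aa.
  have [|c [[hc [c' [hc' [mcc jcc]]]] ca]] := cblp (qpush a).
    by split=> //; exists (qpush a').
  exists c, c'; split=> // x y.
  rewrite -(qpush_class hth _ _ (is_con_cjoin c th) (@rsub_cjoinr _ _ c th)).
  by rewrite -(qcon_qpush hth) ca qpush_class.
have bb : complementary (@Delta _) b b' by split.
have [c [c' [[hc hc' mcc jcc] /req_eq cb]]] :=
  lift _ _ (complementary_qpull hth bb).
exists c; split; first by split=> //; exists c'.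
by move=> X Y; rewrite (qcon_qpush hth) cb qpullK.
Qed.

(* A congruence [b] viewed as a subalgebra of the square of [A]. *)
Section PairAlgebra.
Variables (S : signature) (A : algebra S) (b : prel A).
Hypothesis hb : is_con b.

Definition pair_interp (f : op_sym S)
    (u : 'I_(arity f) -> {p : A * A | b p.1 p.2}) : {p : A * A | b p.1 p.2} :=
  exist (fun p : A * A => b p.1 p.2)
    (interp f (fun i => (proj1_sig (u i)).1),
     interp f (fun i => (proj1_sig (u i)).2))
    (con_op hb (fun i => proj2_sig (u i))).

Definition pair_alg : algebra S := Algebra pair_interp.

Definition mkpair x y (xy : b x y) : pair_alg :=
  exist (fun p : A * A => b p.1 p.2) (x, y) xy.
Definition pr1 (X : pair_alg) : A := (proj1_sig X).1.
Definition pr2 (X : pair_alg) : A := (proj1_sig X).2.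
Definition diag (x : A) : pair_alg := mkpair (con_refl hb x).

Lemma pair_rel (X : pair_alg) : b (pr1 X) (pr2 X).
Proof. exact: proj2_sig X. Qed.

Lemma pair_eq (X Y : pair_alg) : pr1 X = pr1 Y -> pr2 X = pr2 Y -> X = Y.
Proof.
case: X Y => [[x y] ?] [[z t] ?] /= xz yt; apply: eq_exist.
by move: xz yt; rewrite /pr1 /pr2 /= => -> ->.
Qed.

Lemma eval_pair (v : nat -> pair_alg) t :
  pr1 (eval v t) = eval (fun n => pr1 (v n)) t /\
  pr2 (eval v t) = eval (fun n => pr2 (v n)) t.
Proof.
elim: t => [n|f ts IH] //=; rewrite /pr1 /pr2 /=.
by split; congr (interp f _); apply/funext => i; case: (IH i).
Qed.

Lemma in_var_pair (E : identities S) : in_var E A -> in_var E pair_alg.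
Proof.
move=> EA s t st v; have [s1 s2] := eval_pair v s; have [t1 t2] := eval_pair v t.
by apply: pair_eq; rewrite ?s1 ?s2 ?t1 ?t2; exact: EA.
Qed.

Definition preim1 (d : prel A) : prel pair_alg := fun X Y => d (pr1 X) (pr1 Y).
Definition preim2 (d : prel A) : prel pair_alg := fun X Y => d (pr2 X) (pr2 Y).

Lemma is_con_preim1 d : is_con d -> is_con (preim1 d).
Proof.
move=> hd; split; first by move=> X; exact: (con_refl hd).
split; first by move=> X Y; exact: (con_sym hd).
split; first by move=> X Y Z; exact: (con_trans hd).
by move=> f u v; exact: (con_op hd).
Qed.

Lemma is_con_preim2 d : is_con d -> is_con (preim2 d).
Proof.
move=> hd; split; first by move=> X; exact: (con_refl hd).
split; first by move=> X Y; exact: (con_sym hd).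
split; first by move=> X Y Z; exact: (con_trans hd).
by move=> f u v; exact: (con_op hd).
Qed.

Definition swap (X : pair_alg) : pair_alg := mkpair (con_sym hb (pair_rel X)).

Lemma is_con_swap (Psi : prel pair_alg) :
  is_con Psi -> is_con (fun X Y => Psi (swap X) (swap Y)).
Proof.
move=> hP; split; first by move=> X; exact: (con_refl hP).
split; first by move=> X Y; exact: (con_sym hP).
split; first by move=> X Y Z; exact: (con_trans hP).
have swap_op f u : swap (interp f u) = interp f (fun i => swap (u i)).
  exact: pair_eq.
by move=> f u v uv; rewrite !swap_op; exact: (con_op hP).
Qed.

End PairAlgebra.

(* The term condition "[a] centralizes [b] modulo [d]", expressed by a witness
   congruence on the pair algebra in place of the matrices of terms. *)
Definition central (S : signature) (A : algebra S) (a b d : prel A) :=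
  forall hb : is_con b, exists Psi : prel (pair_alg hb),
  [/\ is_con Psi, forall x y, a x y -> Psi (diag hb x) (diag hb y)
    & forall X Y, Psi X Y -> d (pr1 X) (pr2 X) -> d (pr1 Y) (pr2 Y)].

(** The join of the two witnesses serves: its trace on the diagonal is a congruence containing [a1]
    and [a2], and the pairs lying in [d] are saturated for each witness, hence for the join. *)
Lemma centralSl (S : signature) (A : algebra S) (a1 a2 b d : prel A) :
  central a1 b d -> central a2 b d -> central (cjoin a1 a2) b d.
Proof.
move=> C1 C2 hb.
have [P1 [h1 diag1 sat1]] := C1 hb; have [P2 [h2 diag2 sat2]] := C2 hb.
have hJ := is_con_cjoin P1 P2.
exists (cjoin P1 P2); split=> //; last first.
  by move=> X Y; exact: (cjoin_saturated h1 h2 (P := fun X => d (pr1 X) (pr2 X))).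
apply: (@cjoin_least _ _ _ _ (fun x y => cjoin P1 P2 (diag hb x) (diag hb y))).
- split; first by move=> x; exact: (con_refl hJ).
  split; first by move=> x y; exact: (con_sym hJ).
  split; first by move=> x y z; exact: (con_trans hJ).
  have diag_op f u : diag hb (interp f u) = interp f (fun i => diag hb (u i)).
    exact: pair_eq.
  by move=> f u v uv; rewrite !diag_op; exact: (con_op hJ).
- by move=> x y xy; apply: rsub_cjoinl; exact: diag1.
- by move=> x y xy; apply: rsub_cjoinr; exact: diag2.
Qed.

Lemma centralWr (S : signature) (A : algebra S) (a b b' d : prel A) :
  is_con b -> rsub b' b -> central a b d -> central a b' d.
Proof.
move=> hb b'b C hb'; have [P [hP diagP satP]] := C hb.
pose inc (X : pair_alg hb') : pair_alg hb := mkpair hb (b'b _ _ (pair_rel X)).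
exists (fun X Y => P (inc X) (inc Y)); split; last by move=> X Y /satP.
  split; first by move=> X; exact: (con_refl hP).
  split; first by move=> X Y; exact: (con_sym hP).
  split; first by move=> X Y Z; exact: (con_trans hP).
  have inc_op f u : inc (interp f u) = interp f (fun i => inc (u i)).
    exact: pair_eq.
  by move=> f u v uv; rewrite !inc_op; exact: (con_op hP).
have incd x : inc (diag hb' x) = diag hb x by exact: pair_eq.
by move=> x y xy; rewrite !incd; exact: diagP.
Qed.

(** * Consequences of modularity: the shifting lemma and symmetry of centrality *)

Section Modular.
Variables (S : signature) (E : identities S).
Hypothesis HCM : con_modular E.

(** The path [z], [x], [y], [t] puts [(z, t)] in [((a /\ g) \/ b) /\ a], which by modularity is
    [(a /\ g) \/ (b /\ a)], a congruence below [g]. *)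
Lemma shifting (B : algebra S) (a b g : prel B) (x y z t : B) : in_var E B ->
  is_con a -> is_con b -> is_con g -> rsub (cmeet a b) g ->
  a x y -> a z t -> b x z -> b y t -> g x y -> g z t.
Proof.
move=> EB ha hb hg abg axy azt bxz byt gxy.
have hag : is_con (cmeet a g) by exact: is_con_cmeet.
have hJ := is_con_cjoin (cmeet a g) b.
have zt : cmeet (cjoin (cmeet a g) b) a z t.
  split=> //; apply: (con_trans hJ (y := x)).
    by apply: rsub_cjoinr; exact: (con_sym hb).
  apply: (con_trans hJ (y := y)); first exact: rsub_cjoinl.
  exact: rsub_cjoinr.
have /(_ z t) [/(_ zt) + _] := HCM EB hag hb ha (fun _ _ => @proj1 _ _).
by apply: (cjoin_least hg) => u v [? ?] //; exact: abg.
Qed.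

Section Algebra.
Variable A : algebra S.
Hypothesis EA : in_var E A.
Implicit Types a b d e : prel A.

(** The witness relates two pairs when [a] relates them in both coordinates; they then span a
    rectangle to which shifting applies. *)
Lemma central_meet a b d : is_con a -> is_con b -> is_con d ->
  rsub (cmeet a b) d -> central a b d.
Proof.
move=> ha hb hd abd hb'.
exists (cmeet (preim1 (hb := hb') a) (preim2 a)); split.
- by apply: is_con_cmeet; [exact: is_con_preim1|exact: is_con_preim2].
- by [].
- move=> X Y [a1 a2]; apply: (shifting EA hb ha hd) a1 a2.
  + by move=> u v [? ?]; exact: abd.
  + exact: pair_rel.
  + exact: pair_rel.
Qed.

(** View [X] and [Y] as the rows of a 2 by 2 matrix: the witness transfers [d] from one row to the
    other, and this transfers it between columns. It is what makes centrality symmetric. *)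
Lemma central_transpose a b d (hb : is_con b) (Psi : prel (pair_alg hb)) :
  is_con d -> is_con Psi ->
  (forall x y, a x y -> Psi (diag hb x) (diag hb y)) ->
  (forall X Y, Psi X Y -> d (pr1 X) (pr2 X) -> d (pr1 Y) (pr2 Y)) ->
  forall X Y, Psi X Y -> a (pr1 X) (pr1 Y) ->
    d (pr1 X) (pr1 Y) -> d (pr2 X) (pr2 Y).
Proof.
move=> hd hP diagP satP X Y XY aXY dXY.
have hk1 := is_con_preim1 hb (is_con_Delta A).
have hk2 := is_con_preim2 hb (is_con_Delta A).
have EB := in_var_pair (hb := hb) EA.
have ker1 : rsub (cmeet Psi (preim1 (@Delta A))) (preim2 d).
  move=> Z T [ZT]; rewrite /preim1 /Delta => ZT1.
  have zt : b (pr2 Z) (pr2 T).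
    apply: (con_trans hb (y := pr1 Z)); first by apply: (con_sym hb); exact: pair_rel.
    by rewrite ZT1; exact: pair_rel.
  apply: (satP (diag hb (pr2 Z)) (mkpair hb zt)); last exact: con_refl.
  (* Replace the common first coordinate of [Z] and [T] by [pr2 Z]: the kernels of the two
     projections meet in equality, so shifting keeps the pairs [Psi]-related. *)
  apply: (shifting EB hk1 hk2 hP _ _ _ _ _ ZT) => // U V [U1 U2].
  by rewrite (pair_eq U1 U2); exact: con_refl.
(* Shift from the diagonal pairs over [pr1 X] and [pr1 Y] to [X] and [Y], moving within fibres of
   the first projection. *)
exact: (shifting EB hP hk1 (is_con_preim2 hb hd) ker1 (diagP _ _ aXY) XY).
Qed.

Lemma central_sym a b d :
  is_con b -> is_con d -> central a b d -> central b a d.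
Proof.
move=> hb hd C ha; have [P [hP diagP satP]] := C hb.
(* Making the witness invariant under [swap] is what makes the transposed relation [R] symmetric. *)
pose P' : prel (pair_alg hb) := cmeet P (fun X Y => P (swap X) (swap Y)).
have hP' : is_con P' by apply: is_con_cmeet => //; exact: is_con_swap.
have diagP' x y : a x y -> P' (diag hb x) (diag hb y).
  have swapd z : swap (diag hb z) = diag hb z by exact: pair_eq.
  by move=> xy; split; rewrite ?swapd; exact: diagP.
have satP' X Y : P' X Y -> d (pr1 X) (pr2 X) -> d (pr1 Y) (pr2 Y).
  by case=> XY _; exact: satP.
(* [R] consists of the transposed matrices of [P']. It may fail to be transitive, so its equivalence
   closure is the new witness. *)
pose R (X Y : pair_alg ha) := exists (h1 : b (pr1 X) (pr1 Y))
  (h2 : b (pr2 X) (pr2 Y)), P' (mkpair hb h1) (mkpair hb h2).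
have symR X Y : R X Y -> R Y X.
  case=> h1 [h2 [XY YX]]; exists (con_sym hb h1), (con_sym hb h2).
  have swap_mk x y (xy : b x y) : swap (mkpair hb xy) = mkpair hb (con_sym hb xy).
    exact: pair_eq.
  have swapK x y (xy : b x y) : swap (mkpair hb (con_sym hb xy)) = mkpair hb xy.
    exact: pair_eq.
  by split; [rewrite -!swap_mk|rewrite !swapK].
have reflR X : R X X.
  by exists (con_refl hb _), (con_refl hb _); apply: diagP'; exact: pair_rel.
have opR f (u v : 'I_(arity f) -> pair_alg ha) :
    (forall i, R (u i) (v i)) -> R (interp f u) (interp f v).
  move=> uv.
  have h1 i : b (pr1 (u i)) (pr1 (v i)) by case: (uv i).
  have h2 i : b (pr2 (u i)) (pr2 (v i)) by case: (uv i) => ? [].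
  exists (con_op hb h1), (con_op hb h2).
  have := con_op hP' (f := f) (u := fun i => mkpair hb (h1 i))
    (v := fun i => mkpair hb (h2 i)).
  set U := interp f _; set V := interp f _.
  have -> : U = mkpair hb (con_op hb h1) by exact: pair_eq.
  have -> : V = mkpair hb (con_op hb h2) by exact: pair_eq.
  apply=> i; case: (uv i) => k1 [k2].
  by rewrite (Prop_irrelevance (h1 i) k1) (Prop_irrelevance (h2 i) k2).
have satR X Y : R X Y -> d (pr1 X) (pr2 X) -> d (pr1 Y) (pr2 Y).
  case=> h1 [h2 XY].
  by apply: (central_transpose hd hP' diagP' satP' XY); exact: pair_rel.
exists (clos_refl_sym_trans _ R); split.
- apply: is_con_clos_rst => f u v j uv Rj; apply: opR => i.
  by have [->//|/uv ->] := eqVneq i j.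
- by move=> x y xy; apply: rst_step; exists xy, xy; exact: (con_refl hP').
- have RD X Y : R X Y -> (d (pr1 X) (pr2 X) <-> d (pr1 Y) (pr2 Y)).
    by move=> XY; split; [exact: satR|exact/satR/symR].
  by move=> X Y /(clos_rst_saturated (P := fun Z => d (pr1 Z) (pr2 Z)) RD) [].
Qed.

(** * Consequences of semidegeneracy: the distributive law and maximal congruences *)

Hypothesis Hsd : semidegenerate E.

(* The diagonal is a one-element subalgebra of the quotient of the pair algebra
   by the witness, so that quotient is trivial. *)
Lemma central_Nabla e d :
  is_con e -> is_con d -> central (@Nabla A) e d -> rsub e d.
Proof.
move=> he hd C x y xy; have [P [hP diagP satP]] := C he.
have trivial (X Y : quotient_alg P) : X = Y.
  apply: contrapT => XY.
  have EQ := in_var_quotient hP (in_var_pair (hb := he) EA).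
  have nt : nontrivial (quotient_alg P) by exists X, Y.
  apply: (Hsd EQ nt (a := qclass P (diag he x))).
  move=> f u ux; have -> : u = fun i => qclass P (diag he x) by exact/funext.
  rewrite qclass_op //; apply: qclass_eq => //.
  have -> : interp f (fun=> diag he x) = diag he (interp f (fun=> x)).
    exact: pair_eq.
  exact: diagP.
apply: (satP (diag he x) (mkpair he xy)); last exact: con_refl.
exact/(qclass_inj hP)/trivial.
Qed.

Lemma complement_distr a a' d : is_con a -> is_con a' -> is_con d ->
  rsub (cmeet a a') d -> req (cjoin a a') (@Nabla A) ->
  rsub (cmeet (cjoin a d) (cjoin a' d)) d.
Proof.
move=> ha ha' hd aad jaa; set e := cmeet _ _.
have he : is_con e by apply: is_con_cmeet; exact: is_con_cjoin.
(* Modulo [d], both [b] and [d] centralize [b'], hence so does their join; then symmetry. Used for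
   both orders of [a], [a'], it shows that each of them centralizes [e]. *)
have half b b' : is_con b -> is_con b' -> rsub (cmeet b b') d ->
    central b' (cjoin b d) d.
  move=> hb hb' bb; apply: central_sym => //; apply: centralSl => //.
    exact: central_meet.
  by apply: central_meet => // u v [].
apply: central_Nabla => //; rewrite -(req_eq jaa); apply: centralSl => //.
  apply: (centralWr (is_con_cjoin a' d)) => [u v []//|]; apply: half => //.
  by move=> u v [? ?]; exact: aad.
by apply: (centralWr (is_con_cjoin a d)) => [u v []//|]; exact: half.
Qed.

(* By semidegeneracy [Nabla] is generated by the finitely many pairs
   [(x, f (x, ..., x))], so proper congruences are closed under unions of chains. *)
Lemma Nabla_generated g x : is_con g ->
  (forall f : op_sym S, g x (interp f (fun=> x))) -> req g (@Nabla A).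
Proof.
move=> hg gx y z; split=> // _; apply: (qclass_inj hg); apply: contrapT => yz.
have nt : nontrivial (quotient_alg g) by exists (qclass g y), (qclass g z).
apply: (Hsd (in_var_quotient hg EA) nt (a := qclass g x)) => f u ux.
have -> : u = fun i => qclass g x by exact/funext.
by rewrite qclass_op //; apply: qclass_eq => //; exact: con_sym.
Qed.

(** Zorn's lemma on the proper congruences above [g]; finiteness of the signature keeps the union of
    a chain proper. *)
Lemma max_con_exists g : is_con g -> ~ req g (@Nabla A) ->
  exists m, max_con m /\ rsub g m.
Proof.
move=> hg gN.
have [x0 _] : exists x : A, True.
  apply: contrapT => noA; apply: gN => x; case: noA; by exists x.
pose T := {c : prel A | [/\ is_con c, rsub g c & ~ req c (@Nabla A)]}.
pose le (s t : T) := `[< rsub (proj1_sig s) (proj1_sig t) >].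
have [] := @Zorn T le.
- by move=> t; apply/asboolP.
- move=> r s t /asboolP rs /asboolP st; apply/asboolP => x y xy.
  exact/st/rs.
- move=> [s ?] [t ?] /asboolP st /asboolP ts; apply: eq_exist; apply: req_eq.
  exact: rsub_anti.
- move=> F totF.
  have [[t0 Ft0]|F0] := pselect (exists t, F t); last first.
    have gT : [/\ is_con g, rsub g g & ~ req g (@Nabla A)] by split.
    by exists (exist _ g gT) => s Fs; case: F0; exists s.
  pose U : prel A := fun x y => exists2 t, F t & proj1_sig t x y.
  have Tcon (t : T) : is_con (proj1_sig t) by case: (proj2_sig t).
  (* Finitely many pairs of the union lie in one member of the chain. This serves transitivity,
     compatibility with operations and properness. *)
  have dir (I : finType) (u v : I -> A) : (forall i, U (u i) (v i)) ->
      exists2 t, F t & forall i, proj1_sig t (u i) (v i).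
    move=> uv.
    suff [t Ft H] : exists2 t, F t &
        forall i, i \in enum I -> proj1_sig t (u i) (v i).
      by exists t => // i; apply: H; rewrite mem_enum.
    elim: (enum I) => [|j s [t Ft ts]]; first by exists t0.
    have [t' Ft' t'j] := uv j; case: (totF _ _ Ft Ft') => /asboolP tt'.
      exists t' => // i; rewrite inE => /predU1P [->//|/ts]; exact: tt'.
    by exists t => // i; rewrite inE => /predU1P [->|/ts //]; exact: tt'.
  have hU : is_con U.
    split; first by move=> x; exists t0 => //; exact: con_refl.
    split; first by move=> x y [t Ft xy]; exists t => //; exact: con_sym.
    split.
      move=> x y z xy yz.
      have [k|t Ft txyz] := dir bool (fun k => if k then x else y)
        (fun k => if k then y else z); first by case: k.
      by exists t => //; exact: (con_trans (Tcon t) (txyz true) (txyz false)).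
    by move=> f u v /dir [t Ft tuv]; exists t => //; exact: con_op.
  have UT : [/\ is_con U, rsub g U & ~ req U (@Nabla A)].
    split=> //.
      by move=> x y gxy; exists t0 => //; case: (proj2_sig t0) => _ + _; apply.
    (* Were the union [Nabla], a single member would contain all generating pairs and be [Nabla]
       itself. *)
    move=> UN; have [f|t Ft tf] := dir (op_sym S) (fun=> x0)
      (fun f => interp f (fun=> x0)); first exact/UN.
    by have [_ _] := proj2_sig t; apply; exact: Nabla_generated tf.
  by exists (exist _ U UT) => s Fs; apply/asboolP => x y xy; exists s.
move=> [m [hm gm mN]] maxm; exists m; split=> //; split=> //; split=> // c hc mc.
have [cN|cN] := pselect (req c (@Nabla A)); [by right|left].
have cT : [/\ is_con c, rsub g c & ~ req c (@Nabla A)].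
  by split=> // x y /gm /mc.
by have /(congr1 (@proj1_sig _ _)) /= -> := maxm (exist _ c cT) (asboolT mc).
Qed.

Lemma eq_Nabla_max g : is_con g ->
  (forall m, max_con m -> ~ rsub g m) -> req g (@Nabla A).
Proof.
move=> hg nomax; apply: contrapT => /(max_con_exists hg) [m [mm gm]].
exact: nomax mm gm.
Qed.

End Algebra.
End Modular.

(** * Transfer of liftings from [ch] to [th] *)

Theorem theorem5p12 (S : signature) (E : identities S)
  (HCM : con_modular E) (Hsd : semidegenerate E)
  (Hst : standing_assumption E)
  (A : algebra S) (HA : in_var E A)
  (th ch : prel A) (Hth : is_con th) (Hch : is_con ch) (Hsub : rsub th ch)
  (Hmax : forall m : prel A, max_con m -> (rsub th m <-> rsub ch m)) :
  CBLP ch -> CBLP th.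
Proof.
move=> /(CBLPP Hch) lift; apply/(CBLPP Hth) => b b' [hb hb' mbb jbb].
have thb : rsub th b by move=> x y /mbb [].
have distr := complement_distr HCM HA Hsd.
have max_join (m a a' : prel A) : max_con m -> req (cjoin a a') (@Nabla A) ->
    rsub a m -> rsub a' m -> False.
  move=> [hm [mN _]] jaa am a'm; apply: mN => x y; split=> // _.
  by apply: (cjoin_least hm am a'm); apply/jaa.
have [|c [c' [[hc hc' mcc jcc] cb]]] := lift (cjoin b ch) (cjoin b' ch).
  split; [exact: is_con_cjoin..| |].
    apply: rsub_anti => [|x y xy]; last by split; exact: rsub_cjoinr.
    by apply: distr => // x y /mbb /Hsub.
  move=> x y; split=> // _; move: (proj2 (jbb x y) I).
  apply: cjoin_least => [|u v uv|u v uv]; first exact: is_con_cjoin.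
    by apply: rsub_cjoinl; exact: rsub_cjoinl.
  by apply: rsub_cjoinr; exact: rsub_cjoinl.
exists c, c'; split=> //.
(* A maximal [m] above [c'] and [b] contains [th], hence [ch], hence [c] since [c] lies below
   [cjoin b ch]; this contradicts [jcc]. *)
have jc'b : req (cjoin c' b) (@Nabla A).
  apply: (eq_Nabla_max HA Hsd) => [|m mm jm]; first exact: is_con_cjoin.
  have bm : rsub b m by move=> x y xy; apply: jm; exact: rsub_cjoinr.
  have chm : rsub ch m by apply: (proj1 (Hmax _ mm)) => x y /thb /bm.
  apply: (max_join m _ _ mm jcc) => x y xy; last by apply: jm; exact: rsub_cjoinl.
  have hm := proj1 mm; apply: (cjoin_least hm bm chm); apply/cb.
  exact: rsub_cjoinl.
have jcb' : req (cjoin c b') (@Nabla A).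
  apply: (eq_Nabla_max HA Hsd) => [|m mm jm]; first exact: is_con_cjoin.
  have b'm : rsub b' m by move=> x y xy; apply: jm; exact: rsub_cjoinr.
  have cm : rsub c m by move=> x y xy; apply: jm; exact: rsub_cjoinl.
  have chm : rsub ch m by apply: (proj1 (Hmax _ mm)) => x y /mbb [_ /b'm].
  apply: (max_join m _ _ mm jbb _ b'm) => x y xy.
  have hm := proj1 mm; apply: (cjoin_least hm cm chm); apply/cb.
  exact: rsub_cjoinl.
apply: rsub_anti.
  apply: cjoin_least => // x y xy.
  (* With [d := b]: as [cjoin c' b] is [Nabla], the meet contains [c], so [c] lies below [b]. *)
  apply: (distr c c' b) => // [u v /mcc ->|]; first exact: con_refl.
  by split; [exact: rsub_cjoinl|apply/jc'b].
move=> x y xy; have hj := is_con_cjoin c th.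
(* With [d := cjoin c th]: [cjoin b' d] is [Nabla] because it contains [cjoin c b'], so [b] lies
   below [d]. *)
apply: (distr b b' (cjoin c th)) => // [u v /mbb|].
  exact: rsub_cjoinr.
split; first exact: rsub_cjoinl.
move: (proj2 (jcb' x y) I).
apply: cjoin_least => [|u v uv|u v uv]; first exact: is_con_cjoin.
  by apply: rsub_cjoinr; exact: rsub_cjoinl.
exact: rsub_cjoinl.
Qed.
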